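(* Let $\mathbb{S}$, $\mathbb{A}$ be finite non-empty sets, $p(\cdot|s,a)$ a transition kernel such that for every stationary randomized policy $\pi$ the matrix $P^{\pi}$ is irreducible and aperiodic, $c:\mathbb{S}\times\mathbb{A}\to\mathbb{R}_+$ a cost function, and $\gamma\in(0,1)$. Let $\widehat{Q}^n_k$ be the iterates of asynchronous empirical $Q$-value iteration with $n$ samples per update along a sequence $(z_k)_{k\ge 0}$ of state-action pairs. If each state-action pair is visited in turn infinitely often, then $$\widehat{Q}^n_k\to Q^*\quad\text{in probability as } n,k\to\infty .$$
   Context: Stationary randomized policies are maps $\pi:\mathbb{S}\to\mathcal{P}(\mathbb{A})$, where $\mathcal{P}(\mathbb{A})$ is the set of probability measures on $\mathbb{A}$; write $\pi(s,a)$ for the probability of $a$ under $\pi(s)$. Set $P^{\pi}(s,s')=\sum_{a\in\mathbb{A}}p(s'|s,a)\pi(s,a)$. The $Q$-value operator is $G(Q)(s,a)=c(s,a)+\gamma\sum_{s'\in\mathbb{S}}p(s'|s,a)\min_{b\in\mathbb{A}}Q(s',b)$; the optimal $Q$-value function $Q^*$ is its unique fixed point. Simulation function: $\psi:\mathbb{S}\times\mathbb{A}\times[0,1]\to\mathbb{S}$ is a fixed (measurable) function such that $\Pr(\psi(s,a,\xi)=s')=p(s'|s,a)$ for all $s,a,s'$ when $\xi$ is uniform on $[0,1]$. Asynchronous EQVI: for $z=(\sigma,\alpha)\in\mathbb{S}\times\mathbb{A}$ and i.i.d. uniform $[0,1]$ samples $\xi_1,\dots,\xi_n$, the empirical asynchronous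 operator $\widehat{G}_{z,n}$ is $$[\widehat{G}_{z,n}Q](s,a)=\begin{cases}c(\sigma,\alpha)+\frac{\gamma}{n}\sum_{i=1}^n\min_{b\in\mathbb{A}}Q(\psi(\sigma,\alpha,\xi_i),b), & (s,a)=z,\\ Q(s,a), & \text{otherwise.}\end{cases}$$ Starting from an initial seed $\widehat{Q}^n_0=Q_0\in\mathbb{R}_+^{\mathbb{S}\times\mathbb{A}}$, the iterates are $\widehat{Q}^n_{k+1}=\widehat{G}_{z_k,n}\widehat{Q}^n_k$, with fresh independent samples at every step. ''Each state-action pair is visited in turn infinitely often'' means that the sequence $(z_k)$ runs repeatedly through all the state-action pairs one after the other, each full update cycle having length $|\mathbb{S}||\mathbb{A}|$ (i.e. $z_k$ cycles through a fixed enumeration of $\mathbb{S}\times\mathbb{A}$). Convergence in probability as $n,k\to\infty$ means: for all $\epsilon,\delta>0$ there are $N,K$ such that $\Pr(\|\widehat{Q}^n_k-Q^*\|_\infty\ge\epsilon)\le\delta$ for all $n\ge N$, $k\ge K$. *)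

(* Defs.v *)
From HB Require Import structures.
From mathcomp Require Import all_boot all_order all_algebra.
From mathcomp Require Import all_classical all_reals all_analysis.

Set Implicit Arguments.
Unset Strict Implicit.
Unset Printing Implicit Defensive.

Import Order.TTheory GRing.Theory Num.Theory.
Import numFieldNormedType.Exports.

Local Open Scope classical_set_scope.
Local Open Scope ring_scope.

Section MarkovDecisionProcess.
Context {R : realType}.

Definition is_prob (T : finType) (f : T -> R) : Prop :=
  (forall x, 0 <= f x) /\ \sum_x f x = 1.

Definition irreducible_mx (n : nat) (M : 'M[R]_n) : Prop :=
  forall i j, exists k : nat, 0 < (M ^+ k) i j.

(* Every state has period 1: the only common divisor of its return times
   is 1. *)
Definition aperiodic_mx (n : nat) (M : 'M[R]_n) : Prop :=
  forall i (d : nat),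
    (forall k : nat, (0 < k)%N -> 0 < (M ^+ k) i i -> (d %| k)%N) -> d = 1%N.

Context {S A : finType}.

(* [p s a s'] stands for p(s'|s,a). *)
Definition transition_kernel (p : S -> A -> S -> R) : Prop :=
  forall s a, is_prob (p s a).

Definition policy (pi : S -> A -> R) : Prop := forall s, is_prob (pi s).

Definition policy_mx (p : S -> A -> S -> R) (pi : S -> A -> R) : 'M[R]_#|S| :=
  \matrix_(i, j) \sum_a p (enum_val i) a (enum_val j) * pi (enum_val i) a.

(* [a0] only witnesses that A is non-empty; the value does not depend on it. *)
Definition minQ (a0 : A) (Q : S * A -> R) (s : S) : R :=
  \big[Num.min/Q (s, a0)]_(b : A) Q (s, b).

Definition Qop (a0 : A) (p : S -> A -> S -> R) (c : S * A -> R) (gamma : R)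
    (Q : S * A -> R) : S * A -> R :=
  fun sa => c sa + gamma * \sum_(s' : S) p sa.1 sa.2 s' * minQ a0 Q s'.

Definition emp_Qop (a0 : A) (psi : S -> A -> R -> S) (c : S * A -> R)
    (gamma : R) (z : S * A) (n : nat) (x : 'I_n -> R)
    (Q : S * A -> R) : S * A -> R :=
  fun sa => if sa == z
    then c z + gamma / n%:R * \sum_(i < n) minQ a0 Q (psi z.1 z.2 (x i))
    else Q sa.

(* [x k] is the batch of samples used at step k. *)
Fixpoint Qhat (a0 : A) (psi : S -> A -> R -> S) (c : S * A -> R)
    (gamma : R) (z : nat -> S * A) (Q0 : S * A -> R) (n : nat)
    (x : nat -> 'I_n -> R) (k : nat) : S * A -> R :=
  if k is k'.+1
  then emp_Qop a0 psi c gamma (z k') (x k') (Qhat a0 psi c gamma z Q0 x k')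
  else Q0.

Definition sup_norm (Q : S * A -> R) : R :=
  \big[Num.max/0]_(sa : S * A) `|Q sa|.

Definition visited_in_turn (z : nat -> S * A) : Prop :=
  exists2 e : 'I_(#|S| * #|A|) -> S * A, bijective e &
    forall (q : nat) (i : 'I_(#|S| * #|A|)), z (q * (#|S| * #|A|) + i)%N = e i.

(* The unit interval, the domain of [psi s a], is rendered as a subset of R;
   nothing is required of [psi] outside it. *)
Definition simulation_function (p : S -> A -> S -> R)
    (psi : S -> A -> R -> S) : Prop :=
  forall s a s',
    measurable (`[0, 1]%classic `&` psi s a @^-1` [set s']) /\
    uniform_prob (@ltr01 R) (`[0, 1]%classic `&` psi s a @^-1` [set s'])
      = (p s a s')%:E.

End MarkovDecisionProcess.

Section Sampling.
Context {d : measure_display} {T : measurableType d} {R : realType}.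
Variable Pr : probability T R.

(* The sample takes its values in the domain of the simulation function. *)
Definition uniform01 (X : {RV Pr >-> R}) : Prop :=
  (forall w, X w \in `[0, 1]) /\
  forall B : set R, measurable B ->
    distribution Pr X B = uniform_prob (@ltr01 R) B.

Definition mutually_independent (I : eqType) (X : I -> {RV Pr >-> R}) : Prop :=
  forall (s : seq I) (B : I -> set R), uniq s ->
    (forall i, measurable (B i)) ->
    Pr (\bigcap_(i in [set` s]) X i @^-1` B i)
      = (\prod_(i <- s) Pr (X i @^-1` B i))%E.

End Sampling.

(* Main.v *)
(* Compare the sampled update of Q_k at z_k with the exact update of Q* there:
   the difference is at most gamma ||Q_k - Q*|| plus the error of the empirical
   mean of the fixed function min_b Q*( . , b), so no independence between steps
   is needed, only Chebyshev's inequality within one batch. The sampling errors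
   are bounded, hence ||Q_k - Q*|| <= M surely, uniformly in k and n. If the
   sampling errors are at most (1 - gamma) beta throughout L stretches of two
   visiting cycles each, the error bound shrinks to beta + gamma^L M. Looking
   only at the last L stretches before step k keeps the number of bad events in
   the union bound independent of k. *)
Require Import Defs.
From HB Require Import structures.
From mathcomp Require Import all_boot all_order all_algebra.
From mathcomp Require Import all_classical all_reals all_analysis.
From mathcomp Require Import measurable_realfun zify ring lra.

Import Order.TTheory GRing.Theory Num.Theory.
Import numFieldNormedType.Exports.

Local Open Scope classical_set_scope.
Local Open Scope ring_scope.

(** * Weak law of large numbers for indicators of pairwise independent events *)

Section WeakLaw.
Set Implicit Arguments.
Unset Strict Implicit.
Context {d : measure_display} {T : measurableType d} {R : realType}.
Variable P : probability T R.
Local Open Scope ereal_scope.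

Lemma Lfun_indic (r : R) (A : set T) : (1 <= r)%R -> measurable A ->
  (\1_A : T -> R) \in Lfun P r%:E.
Proof.
move=> r1 mA; rewrite inE/=; apply/andP; split.
  by rewrite inE; exact: measurable_indic.
rewrite inE/= /finite_norm unlock poweR_lty//.
apply: (@le_lt_trans _ _ (\int[P]_x 1)); last first.
  by rewrite integral_cst// mul1e -ge0_fin_numE// fin_num_measure.
rewrite [leLHS](_ : _ = \int[P]_x (`|(\1_A x : R)| `^ r)%:E)//.
apply: ge0_le_integral => //.
- apply/measurable_EFinP; apply: (@measurableT_comp _ _ _ _ _ _ (fun x => x `^ r)%R) => //.
  exact: measurableT_comp.
- move=> x _; rewrite lee_fin indicE.
  by case: (x \in A); rewrite ?normr1 ?powR1// normr0 powR0// gt_eqF// (lt_le_trans ltr01).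
Qed.

Lemma covariance_indic (A B : set T) : measurable A -> measurable B ->
  covariance P \1_A \1_B = P (A `&` B) - P A * P B.
Proof.
move=> mA mB; have L1 C : measurable C -> (\1_C : T -> R) \in Lfun P 1.
  exact: Lfun_indic.
have EI : (\1_A * \1_B = \1_(A `&` B) :> (T -> R))%R by rewrite indicI.
rewrite covarianceE ?EI ?L1 ?expectation_indic//; exact: measurableI.
Qed.

Lemma covariance_suml (I : Type) (s : seq I) (X : I -> T -> R) (Y : T -> R) :
    (forall i, X i \in Lfun P 2%:E) -> Y \in Lfun P 2%:E ->
  covariance P (\sum_(i <- s) X i)%R Y = \sum_(i <- s) covariance P (X i) Y.
Proof.
move=> X2 Y2; elim: s => [|i s IH].
  by rewrite !big_nil; exact: covariance_cst_l.
rewrite !big_cons -IH covarianceDl//.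
by rewrite rpred_sum ?lee1n.
Qed.

Lemma variance_sum (I : eqType) (s : seq I) (X : I -> T -> R) :
    uniq s -> (forall i, X i \in Lfun P 2%:E) ->
    (forall i j, i != j -> covariance P (X i) (X j) = 0) ->
  'V_P[(\sum_(i <- s) X i)%R] = \sum_(i <- s) 'V_P[X i].
Proof.
move=> + X2 cov0; elim: s => [_|i s IH /= /andP[si us]].
  by rewrite !big_nil; exact: variance_cst.
rewrite !big_cons -IH// varianceD//; last by rewrite rpred_sum ?lee1n.
(* The cross term vanishes: uniqueness of the list keeps [i] out of the tail, so it only involves
   distinct indices. *)
rewrite covarianceC covariance_suml// [X in _ * X]big_seq.
rewrite [X in _ * X]big1 ?mule0 ?adde0// => j sj.
by apply: cov0; apply: contraNneq si => <-.
Qed.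

(* Chebyshev's inequality, each indicator having variance at most 1. *)
Lemma empirical_frequency_deviation (n : nat) (B : 'I_n -> set T) (q eta : R) :
    (forall i, measurable (B i)) -> (forall i, P (B i) = q%:E) ->
    (forall i j, i != j -> P (B i `&` B j) = P (B i) * P (B j)) ->
    (0 < n)%N -> (0 < eta)%R ->
  P [set w | (eta <= `|n%:R^-1 * \sum_(i < n) \1_(B i) w - q|)%R]
    <= ((n%:R * eta ^+ 2)^-1)%:E.
Proof.
move=> mB PB indB n0 eta0.
pose X i : T -> R := \1_(B i).
have X2 i : X i \in Lfun P 2%:E by apply: Lfun_indic => //; rewrite ler1n.
have X1 i : X i \in Lfun P 1 by exact: Lfun_indic.
have nR0 : (0 < n%:R :> R)%R by rewrite ltr0n.
have mX : measurable_fun setT (\sum_(i < n) X i)%R.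
  rewrite (_ : (\sum_(i < n) X i)%R = (fun w => \sum_(i < n) X i w)%R).
    by apply: measurable_sum => i; exact: measurable_indic.
  by apply/funext => w; rewrite fct_sumE.
pose Y : {RV P >-> R} := HB.pack (\sum_(i < n) X i)%R (isMeasurableFun.Build _ _ _ _ _ mX).
have EY : 'E_P[Y] = (n%:R * q)%:E.
  rewrite (_ : (Y : T -> R) = \sum_(f <- map X (index_enum 'I_n)) f)%R; last first.
    by rewrite big_map.
  rewrite expectation_sum; last by move=> _ /mapP[i _ ->].
  rewrite big_map (eq_bigr (fun=> q%:E)) => [|i _]; last first.
    by rewrite expectation_indic// PB.
  by rewrite sumEFin sumr_const card_ord mulr_natl.
have VY : 'V_P[Y] <= n%:R%:E.
  rewrite variance_sum ?index_enum_uniq//; last first.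
    by move=> i j ij; rewrite covariance_indic// indB// !PB -EFinM subee.
  rewrite (_ : n%:R%:E = \sum_(i < n) 1); last by rewrite sumEFin sumr_const card_ord.
  apply: lee_sum => i _; rewrite /variance covariance_indic// setIid PB -EFinM -EFinB lee_fin.
  have := probability_le1 P (mB i); rewrite PB lee_fin; have := sqr_ge0 q.
  by rewrite expr2; lra.
(* Applied to the unnormalised sum at threshold [n * eta]: a variance of at most [n] leaves
   [1 / (n * eta^2)]. *)
have := @chebyshev _ _ _ P Y (n%:R * eta)%R (mulr_gt0 nR0 eta0).
rewrite EY /= => H; apply: (@le_trans _ _ (((n%:R * eta) ^- 2)%:E * n%:R%:E)); last first.
  rewrite -EFinM lee_fin le_eqVlt; apply/orP; left; apply/eqP; field.
  by rewrite !gt_eqF.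
apply: (le_trans _ (le_trans H _)).
  rewrite le_eqVlt; apply/orP; left; apply/eqP; congr (P _); apply/seteqP.
  have E w : (`|(\sum_(i < n) X i)%R w - n%:R * q| = n%:R * `|n%:R^-1 * \sum_(i < n) \1_(B i) w - q|)%R.
    rewrite -[X in (X * `|_|)%R](ger0_norm (ltW nR0)) -normrM fct_sumE mulrBr mulrA.
    by rewrite divff ?mul1r// gt_eqF.
  by split=> w /=; rewrite E ler_pM2l.
by rewrite lee_pmul2l// lte_fin invr_gt0 exprn_gt0// mulr_gt0.
Qed.

End WeakLaw.

(** * Measurability of finitely determined events, and the union bound *)

Section FiniteEvents.
Context {d : measure_display} {T : measurableType d} {R : realType}.
Set Implicit Arguments.
Unset Strict Implicit.

Lemma measurable_fin_valued (F : finType) (f : T -> F) (E : set F) :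
  (forall v, measurable [set w | f w = v]) -> measurable [set w | E (f w)].
Proof.
move=> mf; rewrite (_ : [set _ | _] = \bigcup_(v in E) [set w | f w = v]).
  exact: fin_bigcup_measurable.
by apply/seteqP; split=> [w Ew|w [v Ev /= ->]]//; exists (f w).
Qed.

Lemma measurable_fin_family (I F : finType) (f : I -> T -> F) (v : I -> F) :
  (forall i v, measurable [set w | f i w = v]) ->
  measurable [set w | forall i, f i w = v i].
Proof.
move=> mf; rewrite (_ : [set _ | _] = \bigcap_(i in setT) [set w | f i w = v i]).
  exact: fin_bigcap_measurable.
by apply/seteqP; split=> [w H i _|w H i]; exact: H.
Qed.

(* [E] need not be measurable: [Qhat] depends on the samples only through
   finitely many sampled states. *)
Lemma measurable_Qhat (S A : finType) (a0 : A) (c : S * A -> R) (gamma : R)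
    (psi : S -> A -> R -> S) (z : nat -> S * A) (Q0 : S * A -> R) (n : nat)
    (x : T -> nat -> 'I_n -> R) :
  (forall j i s a s', measurable [set w | psi s a (x w j i) = s']) ->
  forall k (E : set (S * A -> R)),
    measurable [set w | E (Qhat a0 psi c gamma z Q0 (x w) k)].
Proof.
move=> mpsi; elim=> [|k IH] E /=.
  by have [EQ|EQ] := pselect (E Q0); [rewrite (_ : [set _ | _] = setT)
    | rewrite (_ : [set _ | _] = set0)] => //; apply/seteqP; split.
pose step (v : {ffun 'I_n -> S}) Q sa := if sa == z k
  then c (z k) + gamma / n%:R * \sum_(i < n) minQ a0 Q (v i) else Q sa.
(* Split by the vector [v] of sampled states: on each of these finitely many pieces the update is
   the fixed map [step v], so the induction hypothesis applies to the preimage of [E]. *)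
rewrite (_ : [set _ | _] = \bigcup_(v in [set: {ffun 'I_n -> S}])
  ([set w | forall i, psi (z k).1 (z k).2 (x w k i) = v i] `&`
   [set w | E (step v (Qhat a0 psi c gamma z Q0 (x w) k))])).
  apply: fin_bigcup_measurable => // v _; apply: measurableI.
    by apply: measurable_fin_family => i s'; exact: mpsi.
  exact: (IH [set Q | E (step v Q)]).
have stepE w (v : {ffun 'I_n -> S}) Q :
    (forall i, psi (z k).1 (z k).2 (x w k i) = v i) ->
    emp_Qop a0 psi c gamma (z k) (x w k) Q = step v Q.
  by move=> xv; rewrite /emp_Qop /step; under eq_bigr do rewrite xv.
apply/seteqP; split=> [w /= Ew|w [v _ [/= xv]]]; last by rewrite (stepE w v).
exists [ffun i => psi (z k).1 (z k).2 (x w k i)] => //=.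
have xv i : psi (z k).1 (z k).2 (x w k i) =
    [ffun i => psi (z k).1 (z k).2 (x w k i)] i by rewrite ffunE.
by split=> //; rewrite -(stepE w).
Qed.

Lemma union_bound (P : probability T R) (I : finType) (B : I -> set T)
    (D : set T) (b : R) :
  (forall i, measurable (B i)) -> measurable D -> D `<=` \bigcup_i B i ->
  (forall i, P (B i) <= b%:E)%E -> (P D <= (#|I|%:R * b)%:E)%E.
Proof.
move=> mB mD DB PB.
have fI : finite_set [set: I] by [].
apply: le_trans (content_sub_fsum P fI (fun i _ => mB i) mD DB) _.
rewrite (fsbigE (index_enum I)) ?index_enum_uniq//=; last first.
  by move=> i _; rewrite mem_index_enum.
under eq_bigl do rewrite in_setT.
apply: le_trans (lee_sum _ (fun i _ => PB i)) _.
by rewrite sumEFin sumr_const mulr_natl.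
Qed.

End FiniteEvents.

(** * Minima over actions and visits within a window *)

Section Deterministic.
Set Implicit Arguments.
Unset Strict Implicit.
Context {R : realType} {S A : finType}.
Implicit Types Q : S * A -> R.

Lemma minQ_le (a0 : A) Q s b : minQ a0 Q s <= Q (s, b).
Proof. exact: bigmin_le_cond. Qed.

Lemma minQ_le_add (a0 : A) Q Q' M s :
  (forall b, Q (s, b) <= Q' (s, b) + M) -> minQ a0 Q s <= minQ a0 Q' s + M.
Proof.
move=> QQ'; rewrite -lerBlDr; apply: le_bigmin => [|b _]; rewrite lerBlDr;
  exact: le_trans (minQ_le _ _ _ _) (QQ' _).
Qed.

Lemma minQ_dist (a0 : A) Q Q' M s :
  (forall b, `|Q (s, b) - Q' (s, b)| <= M) -> `|minQ a0 Q s - minQ a0 Q' s| <= M.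
Proof.
(* Quantified over both functions so that it serves for either sign of the difference. *)
move=> QQ'; have H Q1 Q2 : (forall b, `|Q1 (s, b) - Q2 (s, b)| <= M) ->
    minQ a0 Q1 s - minQ a0 Q2 s <= M.
  move=> QM; rewrite lerBlDl; apply: minQ_le_add => b.
  by rewrite -lerBlDl (le_trans (ler_norm _)).
by rewrite ler_norml lerNl opprB !H// => b; rewrite distrC.
Qed.

Lemma sup_norm_lt Q M : 0 < M -> (forall sa, `|Q sa| < M) -> sup_norm Q < M.
Proof. by move=> M0 QM; apply: bigmax_lt. Qed.

Lemma le_sup_norm Q sa : `|Q sa| <= sup_norm Q.
Proof. exact: le_bigmax_cond. Qed.

(** Whatever the phase of [t], two cycle lengths leave room for the complete cycle that starts at
    the first multiple of the cycle length after [t]. *)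
Lemma visited_in_window (z : nat -> S * A) (t : nat) (sa : S * A) :
  visited_in_turn z ->
  exists2 j, (t <= j < t + 2 * (#|S| * #|A|))%N & z j = sa.
Proof.
case=> e [f ef fe] ze; move: e f ef fe ze; set m := (#|S| * #|A|)%N => e f ef fe ze.
have fm : (f sa < m)%N by exact: ltn_ord.
have m0 : (0 < m)%N by exact: leq_ltn_trans fm.
exists ((t %/ m).+1 * m + f sa)%N; last by rewrite ze fe.
have := ltn_ceil t m0; have := leq_divM t m.
rewrite mulSn; move: (_ * m)%N => x; lia.
Qed.

(* [e] stands for the pointwise distance to the fixed point and [noise] for the
   sampling error of each update. *)
Definition noisy_contraction (gamma : R) (z : nat -> S * A) (noise : nat -> R)
    (e : nat -> S * A -> R) : Prop :=
  forall j M, (forall sa, e j sa <= M) ->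
    e j.+1 (z j) <= gamma * M + noise j /\
    forall sa, sa != z j -> e j.+1 sa = e j sa.

(** * Decay of the error under a noisy contraction *)

Section NoisyContraction.
Variables (gamma : R) (z : nat -> S * A) (noise : nat -> R) (e : nat -> S * A -> R).
Hypothesis he : noisy_contraction gamma z noise e.

(** An updated coordinate gets at most [gamma * M + beta <= M] and the others keep their values, so
    the level [M] is invariant. This serves both for the sure bound from time 0 and inside one
    window. *)
Lemma noisy_contraction_stable (t l : nat) (beta M : R) :
  gamma * M + beta <= M ->
  (forall j, (t <= j < t + l)%N -> noise j <= beta) ->
  (forall sa, e t sa <= M) -> forall j sa, (j <= l)%N -> e (t + j)%N sa <= M.
Proof.
move=> gM nb e0; elim=> [|j IH] sa jl; first by rewrite addn0.
have [ez enz] := he (fun sa => IH sa (ltnW jl)).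
have := nb (t + j)%N; rewrite leq_addr ltn_add2l jl => /(_ isT) nj.
rewrite addnS; have [->|/enz ->] := eqVneq sa (z (t + j)%N); last exact: IH (ltnW jl).
by apply: le_trans ez _; lra.
Qed.

(** Every coordinate is updated in the window. As all errors stay below [M] meanwhile, that update
    and any later one bring it down to the new level, and between updates it is constant. *)
Lemma noisy_contraction_window (t : nat) (beta M : R) :
  visited_in_turn z -> gamma * M + beta <= M ->
  (forall j, (t <= j < t + 2 * (#|S| * #|A|))%N -> noise j <= beta) ->
  (forall sa, e t sa <= M) ->
  forall sa, e (t + 2 * (#|S| * #|A|))%N sa <= gamma * M + beta.
Proof.
move=> hz gM nb e0 sa; have [j /andP[tj]] := visited_in_window t sa hz.
move: nb; set l := (2 * _)%N => nb jtl zj.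
have eM i : (i <= l)%N -> forall sa, e (t + i)%N sa <= M.
  by move=> il sa'; exact: (noisy_contraction_stable gM nb e0).
have step i : (t <= i < t + l)%N ->
    e i.+1 (z i) <= gamma * M + beta /\
    forall sa, sa != z i -> e i.+1 sa = e i sa.
  move=> /[dup] itl /andP[ti il]; have := eM (i - t)%N; rewrite subnKC// => H.
  have [ez enz] := he (H ltac:(lia)).
  by split=> //; apply: le_trans ez _; have := nb _ itl; lra.
(* Induction on the time elapsed since the visit at [j]; the end of the window is
   [i = t + l - j - 1]. *)
suff E i : (j + i < t + l)%N -> e (j + i).+1 sa <= gamma * M + beta.
  by have := E (t + l - j).-1; rewrite (_ : (j + _).+1 = t + l)%N; [apply|]; lia.
elim: i => [|i IH] jil.
  rewrite addn0 -zj; apply: (proj1 (step _ _)); rewrite tj; lia.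
have [ez enz] : _ /\ _ := step (j + i.+1)%N ltac:(lia).
have [->//|/enz ->] := eqVneq sa (z (j + i.+1)%N).
by rewrite addnS; apply: IH; lia.
Qed.

(** Since [beta] is the fixed point of [r |-> gamma * r + (1 - gamma) * beta], each window
    multiplies the excess over [beta] by [gamma]. *)
Lemma noisy_contraction_windows (t L : nat) (beta M : R) :
  visited_in_turn z -> 0 <= gamma < 1 -> 0 <= M ->
  (forall j, (t <= j < t + L * (2 * (#|S| * #|A|)))%N ->
     noise j <= (1 - gamma) * beta) ->
  (forall sa, e t sa <= beta + M) ->
  forall sa, e (t + L * (2 * (#|S| * #|A|)))%N sa <= beta + gamma ^+ L * M.
Proof.
move=> hz /andP[g0 g1] M0; elim: L => [|L IH] nb e0 sa.
  by rewrite mul0n addn0 expr0 mul1r.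
have gLM : 0 <= gamma ^+ L * M by rewrite mulr_ge0 ?exprn_ge0.
rewrite mulSnr addnA exprS.
rewrite (_ : beta + _ = gamma * (beta + gamma ^+ L * M) + (1 - gamma) * beta); last by ring.
apply: noisy_contraction_window => //.
- by nra.
- by move=> j jt; apply: nb; lia.
- by apply: IH => // j jt; apply: nb; lia.
Qed.

End NoisyContraction.
End Deterministic.

(** * Sampling errors and their effect on the iterates *)

Section SamplingError.
Context {R : realType} {S A : finType}.
Set Implicit Arguments.
Unset Strict Implicit.
Variables (a0 : A) (p : S -> A -> S -> R) (c : S * A -> R) (gamma : R).
Variables (Qstar : S * A -> R) (psi : S -> A -> R -> S) (z : nat -> S * A).
Variables (Q0 : S * A -> R) (n : nat) (x : nat -> 'I_n -> R).

(** Frequencies of single states are means of indicators, to which the weak law applies directly. *)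
Definition transition_deviation (j : nat) (s' : S) : R :=
  `|n%:R^-1 * \sum_(i < n) (psi (z j).1 (z j).2 (x j i) == s')%:R
    - p (z j).1 (z j).2 s'|.

(** Distance between the sampled and the exact update of [Qstar] itself; the cost cancels. *)
Definition sampling_error (j : nat) : R :=
  `|gamma / n%:R * \sum_(i < n) minQ a0 Qstar (psi (z j).1 (z j).2 (x j i))
    - gamma * \sum_s' p (z j).1 (z j).2 s' * minQ a0 Qstar s'|.

(** Grouping the samples by the state they produce turns the empirical mean into a sum over states
    weighted by frequencies; the factor [gamma] is bounded by 1. *)
Lemma sampling_error_le (j : nat) (eta : R) : 0 <= gamma < 1 ->
  (forall s', transition_deviation j s' <= eta) ->
  sampling_error j <= (\sum_s' `|minQ a0 Qstar s'|) * eta.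
Proof.
move=> /andP[g0 g1] dev; have s0 := (z j).1.
have eta0 : 0 <= eta by exact: le_trans (normr_ge0 _) (dev s0).
rewrite /sampling_error.
have -> : \sum_(i < n) minQ a0 Qstar (psi (z j).1 (z j).2 (x j i)) =
    \sum_s' (\sum_(i < n) (psi (z j).1 (z j).2 (x j i) == s')%:R) * minQ a0 Qstar s'.
  under [RHS]eq_bigr do rewrite mulr_suml.
  rewrite exchange_big/=; apply: eq_bigr => i _.
  rewrite (bigD1 (psi (z j).1 (z j).2 (x j i)))//= eqxx mul1r big1 ?addr0// => s' /negPf.
  by rewrite eq_sym => ->; rewrite mul0r.
rewrite -mulrA -mulrBr mulr_sumr -sumrB normrM ger0_norm//.
rewrite -[leRHS]mul1r ler_pM ?(ltW g1)// mulr_suml.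
apply: le_trans (ler_norm_sum _ _ _) _; apply: ler_sum => s' _.
by rewrite mulrA -mulrBl normrM mulrC ler_wpM2l// dev.
Qed.

(** Two numbers in [0, 1] are compared. This is the sure bound on the noise that keeps the iterates
    bounded. *)
Lemma transition_deviation_le1 (j : nat) (s' : S) :
  transition_kernel p -> transition_deviation j s' <= 1.
Proof.
move=> hp; have [p0 p1] := hp (z j).1 (z j).2.
have ps1 : p (z j).1 (z j).2 s' <= 1.
  by rewrite -p1 (bigD1 s')//= lerDl sumr_ge0.
rewrite /transition_deviation; have := p0 s'.
move: (p _ _ _) ps1 => q q1 q0; set f := (_ * _).
have f0 : 0 <= f by rewrite mulr_ge0 ?invr_ge0 ?sumr_ge0.
have f1 : f <= 1.
  rewrite /f; case: (posnP n) => [n0|n0].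
    by rewrite [in n%:R^-1]n0 invr0 mul0r.
  rewrite ler_pdivrMl ?ltr0n// mulr1 -[n in leRHS]card_ord -sumr_const.
  by apply: ler_sum => i _; rewrite lern1 leq_b1.
by rewrite ler_norml; apply/andP; split; lra.
Qed.

Lemma Qhat_noisy_contraction : 0 <= gamma -> (0 < n)%N ->
  Qop a0 p c gamma Qstar = Qstar ->
  noisy_contraction gamma z sampling_error
    (fun k sa => `|Qhat a0 psi c gamma z Q0 x k sa - Qstar sa|).
Proof.
move=> g0 n0 fixQ j M eM; split=> [|sa sz]; last by rewrite /= /emp_Qop (negPf sz).
rewrite /= /emp_Qop eqxx -fixQ /Qop /sampling_error.
set Qj := Qhat _ _ _ _ _ _ _ _ in eM *.
set u := \sum_(i < n) _; set v := \sum_(i < n) _; set w := \sum_s' _.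
(* Here [gamma / n * v] comes from updating [Qstar] with the same samples: the first term contracts
   because minima are nonexpansive, the second is the sampling error. *)
rewrite (_ : _ - _ = gamma / n%:R * (u - v) + (gamma / n%:R * v - gamma * w)); last by ring.
apply: le_trans (ler_normD _ _) _; rewrite lerD2r.
have nR0 : 0 < n%:R :> R by rewrite ltr0n.
rewrite normrM ger0_norm ?divr_ge0// -mulrA ler_wpM2l// ler_pdivrMl//.
rewrite /u /v -sumrB (le_trans (ler_norm_sum _ _ _))//.
rewrite mulr_natl -[n in leRHS]card_ord -sumr_const.
by apply: ler_sum => i _; apply: minQ_dist => b; exact: eM.
Qed.

(** The error is surely at most [M] at every time: noise of at most [v] leaves invariant any level
    from [v / (1 - gamma)] up, and [M] also covers the initial error. Hence small deviations are
    demanded only on the [W] steps after [t]. *)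
Lemma Qhat_near_fixpoint (t L : nat) (beta eta : R) :
  let v := \sum_s' `|minQ a0 Qstar s'| in
  let M := sup_norm (fun sa => Q0 sa - Qstar sa) + v / (1 - gamma) in
  let W := (L * (2 * (#|S| * #|A|)))%N in
  0 < gamma < 1 -> (0 < n)%N -> transition_kernel p ->
  Qop a0 p c gamma Qstar = Qstar -> visited_in_turn z ->
  v * eta <= (1 - gamma) * beta -> 0 <= beta ->
  (forall j s', (t <= j < t + W)%N -> transition_deviation j s' <= eta) ->
  forall sa, `|Qhat a0 psi c gamma z Q0 x (t + W) sa - Qstar sa|
    <= beta + gamma ^+ L * M.
Proof.
move=> v M W /andP[g0 g1] n0 hp fixQ hz veta beta0 dev.
have gg : 0 <= gamma < 1 by rewrite ltW.
have cQ := Qhat_noisy_contraction (ltW g0) n0 fixQ.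
have v0 : 0 <= v by rewrite sumr_ge0.
have g1' : 0 < 1 - gamma by rewrite subr_gt0.
have E0 := le_sup_norm (fun sa => Q0 sa - Qstar sa).
have EM : 0 <= sup_norm (fun sa => Q0 sa - Qstar sa) by exact: bigmax_ge_id.
have M0 : 0 <= M by rewrite addr_ge0 ?divr_ge0// ltW.
have bounded sa : `|Qhat a0 psi c gamma z Q0 x t sa - Qstar sa| <= M.
  apply: (@noisy_contraction_stable _ _ _ _ _ _ _ cQ 0 t v M) => //.
  - have -> : gamma * M + v = M - (1 - gamma) * sup_norm (fun sa => Q0 sa - Qstar sa).
      by rewrite /M; field; rewrite gt_eqF.
    by rewrite gerBl mulr_ge0// ltW.
  - move=> j _; rewrite -[leRHS]mulr1; apply: sampling_error_le => // s'.
    exact: transition_deviation_le1.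
  - by move=> sa'; apply: le_trans (E0 sa') _; rewrite lerDl divr_ge0// ltW.
apply: (noisy_contraction_windows cQ) => //.
  move=> j jt; apply: le_trans veta; apply: sampling_error_le => // s'; exact: dev.
by move=> sa; apply: le_trans (bounded sa) _; rewrite lerDr.
Qed.

End SamplingError.

(** * Distribution of the sampled transitions *)

Section SampledTransitions.
Context {d : measure_display} {T : measurableType d} {R : realType}.
Variable Pr : probability T R.
Set Implicit Arguments.
Unset Strict Implicit.
Context {S A : finType}.
Variables (p : S -> A -> S -> R) (psi : S -> A -> R -> S).
Hypothesis hpsi : simulation_function p psi.

(** The samples lie in the unit interval, the only place where [psi] is controlled. *)
Lemma sampled_transitionE (X : {RV Pr >-> R}) (s : S) (a : A) (s' : S) :
  uniform01 X ->
  [set w | psi s a (X w) = s'] =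
    X @^-1` (`[0, 1]%classic `&` psi s a @^-1` [set s']).
Proof.
case=> X01 _; apply/seteqP; split=> w /= => [Xw|[]//].
by split=> //; have := X01 w.
Qed.

Lemma measurable_sampled_transition (X : {RV Pr >-> R}) (s : S) (a : A) (s' : S) :
  uniform01 X -> measurable [set w | psi s a (X w) = s'].
Proof.
move=> uX; rewrite sampled_transitionE//.
by apply: measurable_funPTI; have [] := hpsi s a s'.
Qed.

Lemma probability_sampled_transition (X : {RV Pr >-> R}) (s : S) (a : A) (s' : S) :
  uniform01 X -> Pr [set w | psi s a (X w) = s'] = (p s a s')%:E.
Proof.
move=> uX; rewrite sampled_transitionE//; have [mB <-] := hpsi s a s'.
by rewrite -(proj2 uX).
Qed.

Variables (n : nat) (X : nat -> 'I_n -> {RV Pr >-> R}).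
Hypothesis uX : forall k i, uniform01 (X k i).
Hypothesis indX : mutually_independent (fun ki : nat * 'I_n => X ki.1 ki.2).

Lemma sampled_transition_indep (k : nat) (i j : 'I_n) (s : S) (a : A) (s' : S) :
  i != j ->
  (Pr ([set w | psi s a (X k i w) = s'] `&` [set w | psi s a (X k j w) = s'])
   = Pr [set w | psi s a (X k i w) = s'] * Pr [set w | psi s a (X k j w) = s'])%E.
Proof.
move=> ij; rewrite !sampled_transitionE//; set B := _ `&` psi s a @^-1` _.
have mB : measurable B by have [] := hpsi s a s'.
(* Independence is used for two distinct samples of one batch, with the same Borel set [B]. *)
have u : uniq [:: (k, i); (k, j)].
  by rewrite /= inE andbT xpair_eqE eqxx.
have := indX (B := fun=> B) u (fun=> mB).
rewrite big_cons big_seq1 /= => <-; congr (Pr _); apply/seteqP; split=> w.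
  by move=> [Xi Xj] ki /=; rewrite !inE => /orP[] /eqP ->.
by move=> H; split; [apply: (H (k, i))|apply: (H (k, j))]; rewrite /= !inE eqxx ?orbT.
Qed.

Lemma transition_deviation_prob (z : nat -> S * A) (k : nat) (s' : S) (eta : R) :
  (0 < n)%N -> 0 < eta ->
  (Pr [set w | (eta <= transition_deviation p psi z (fun j i => X j i w) k s')%R]
    <= ((n%:R * eta ^+ 2)^-1)%:E)%E.
Proof.
move=> n0 eta0; pose B i := [set w | psi (z k).1 (z k).2 (X k i w) = s'].
have PB i : Pr (B i) = (p (z k).1 (z k).2 s')%:E.
  exact: probability_sampled_transition.
have mB i : measurable (B i) by exact: measurable_sampled_transition.
have := empirical_frequency_deviation mB PB _ n0 eta0.
move=> /(_ (fun i j => @sampled_transition_indep k i j _ _ _)).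
congr (Pr _ <= _)%E; apply/seteqP; rewrite /transition_deviation.
have E w : \sum_(i < n) \1_(B i) w =
    \sum_(i < n) (psi (z k).1 (z k).2 (X k i w) == s')%:R :> R.
  apply: eq_bigr => i _; rewrite indicE; congr (_ : bool)%:R.
  by apply/idP/eqP; rewrite inE.
by split=> w /=; rewrite E.
Qed.

Lemma measurable_transition_deviation (z : nat -> S * A) (k : nat) (s' : S)
    (E : set R) :
  measurable [set w | E (transition_deviation p psi z (fun j i => X j i w) k s')].
Proof.
pose f w : {ffun 'I_n -> S} := [ffun i => psi (z k).1 (z k).2 (X k i w)].
rewrite (_ : [set _ | _] = [set w | [set v : {ffun 'I_n -> S} |
    E `|n%:R^-1 * \sum_(i < n) (v i == s')%:R - p (z k).1 (z k).2 s'|] (f w)]).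
  apply: measurable_fin_valued => v.
  rewrite (_ : [set _ | _] = [set w | forall i, psi (z k).1 (z k).2 (X k i w) = v i]).
    apply: measurable_fin_family => i s''; exact: measurable_sampled_transition.
  apply/seteqP; split=> w /= => [<- i|H]; first by rewrite ffunE.
  by apply/ffunP => i; rewrite ffunE.
have F w : transition_deviation p psi z (fun j i => X j i w) k s' =
    `|n%:R^-1 * \sum_(i < n) (f w i == s')%:R - p (z k).1 (z k).2 s'|.
  by rewrite /transition_deviation; under [in RHS]eq_bigr do rewrite ffunE.
by apply/seteqP; split=> w /=; rewrite F.
Qed.

End SampledTransitions.

(** * Choice of constants and convergence in probability *)

Lemma expr_lt_eps (R : realType) (gamma M eps : R) :
  0 < gamma < 1 -> 0 < eps -> exists L : nat, gamma ^+ L * M < eps.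
Proof.
move=> /andP[g0 g1] eps0.
have g : `|gamma| < 1 by rewrite ger0_norm// ltW.
have /cvgrPdist_lt/(_ _ eps0)[L _ HL] := cvg_geometric M g.
exists L; have := HL L (leqnn L); rewrite sub0r normrN /= mulrC.
exact: le_lt_trans (ler_norm _).
Qed.

Theorem theorem4p1 (R : realType) (S A : finType) (s0 : S) (a0 : A)
    (p : S -> A -> S -> R) (c : S * A -> R) (gamma : R)
    (hp : transition_kernel p)
    (herg : forall pi : S -> A -> R, policy pi ->
       irreducible_mx (policy_mx p pi) /\ aperiodic_mx (policy_mx p pi))
    (hc : forall sa, 0 <= c sa)
    (hgamma : 0 < gamma < 1)
    (Qstar : S * A -> R) (hQstar : Qop a0 p c gamma Qstar = Qstar)
    (psi : S -> A -> R -> S) (hpsi : simulation_function p psi)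
    (d : measure_display) (T : measurableType d) (Pr : probability T R)
    (xi : forall n : nat, nat -> 'I_n -> {RV Pr >-> R})
    (hunif : forall n k i, uniform01 (xi n k i))
    (hindep : forall n : nat,
       mutually_independent (fun ki : nat * 'I_n => xi n ki.1 ki.2))
    (z : nat -> S * A) (hz : visited_in_turn z)
    (Q0 : S * A -> R) (hQ0 : forall sa, 0 <= Q0 sa) :
  forall eps delta : R, 0 < eps -> 0 < delta ->
    exists N K : nat, forall n k : nat, (N <= n)%N -> (K <= k)%N ->
      (Pr [set w : T |
            (eps <= sup_norm (fun sa =>
               Qhat a0 psi c gamma z Q0 (fun j i => xi n j i w) k sa
                 - Qstar sa))%R]
        <= delta%:E)%E.
Proof.
move=> eps delta eps0 delta0.
pose v := \sum_s' `|minQ a0 Qstar s'|.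
pose M := sup_norm (fun sa => Q0 sa - Qstar sa) + v / (1 - gamma).
have eps2 : 0 < eps / 2 by rewrite divr_gt0.
have [L LM] := expr_lt_eps M hgamma eps2.
pose W := (L * (2 * (#|S| * #|A|)))%N.
have v0 : 0 <= v by rewrite sumr_ge0.
have v1 : 0 < v + 1 by lra.
have g1 : 0 < 1 - gamma by case/andP: hgamma; lra.
(* Chosen so that [v * eta <= (1 - gamma) * (eps / 2)]; the denominator [v + 1] covers [v = 0]. *)
pose eta := (1 - gamma) * (eps / 2) / (v + 1).
have eta0 : 0 < eta by rewrite divr_gt0// mulr_gt0.
have veta : v * eta <= (1 - gamma) * (eps / 2).
  have <- : (v + 1) * eta = (1 - gamma) * (eps / 2).
    by rewrite /eta mulrC divfK// gt_eqF.
  by rewrite ler_wpM2r ?(ltW eta0)//; lra.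
have etasq0 : 0 < eta ^+ 2 by rewrite exprn_gt0.
(* For [n >= b], the number of bad events times the Chebyshev bound [1 / (n * eta^2)] is at most
   [delta]. *)
pose b := #|{: 'I_W * S}|%:R / (eta ^+ 2 * delta).
(* The successor forces [n > 0], and [W <= k] makes the subtraction [k - W] exact. *)
exists (Num.truncn b).+1, W => n k Nn Wk.
have n0 : (0 < n)%N by exact: leq_trans Nn.
have bn : b <= n%:R.
  by apply: ltW; apply: lt_le_trans (truncnS_gt b) _; rewrite ler_nat.
have nR0 : 0 < n%:R :> R by rewrite ltr0n.
pose X w j i := xi n j i w.
pose Bad (js : 'I_W * S) := [set w | eta <= transition_deviation p psi z (X w) (k - W + js.1) js.2].
apply: (@le_trans _ _ (#|{: 'I_W * S}|%:R * (n%:R * eta ^+ 2)^-1)%:E); last first.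
  move: bn; rewrite lee_fin /b !ler_pdivrMr ?(mulr_gt0 nR0 etasq0) ?(mulr_gt0 etasq0 delta0)//.
  by rewrite mulrA [delta * _]mulrC.
apply: (@union_bound _ _ _ Pr _ Bad).
- move=> js; apply: (measurable_transition_deviation hpsi (hunif n) z (k - W + js.1) js.2 [set r | eta <= r]).
- apply: (measurable_Qhat a0 c gamma z Q0 (x := X) _ k
    [set Q | eps <= sup_norm (fun sa => Q sa - Qstar sa)]) => j i s a s'.
  exact: (measurable_sampled_transition hpsi).
(* Outside the bad events all deviations in the last [W] steps are below [eta], so the error is at
   most [eps / 2 + gamma^L * M], which is less than [eps] by the choice of [L]. *)
- move=> w /= epsw; apply: contrapT => nbad.
  suff : sup_norm (fun sa => Qhat a0 psi c gamma z Q0 (X w) k sa - Qstar sa) < eps.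
    by rewrite ltNge epsw.
  apply: sup_norm_lt => // sa; apply: (@le_lt_trans _ _ (eps / 2 + gamma ^+ L * M)).
    rewrite -(subnK Wk); apply: Qhat_near_fixpoint veta _ _ sa => //; first exact: ltW.
    move=> j s' /andP[tj jW]; rewrite leNgt; apply/negP => /ltW bad.
    have jW' : (j - (k - W) < W)%N by rewrite ltn_subLR.
    by apply: nbad; exists (Ordinal jW', s') => //; rewrite /Bad /= subnKC.
  by rewrite [ltRHS]splitr ltrD2l.
- move=> [j s']; exact: (transition_deviation_prob hpsi (hunif n) (hindep n)).
Qed.
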